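(* Assume that $V:(0,\infty)\to\mathbb{R}$ is $C^2((0,\infty))$ and such that $V(x^2)-\rho x^2$ is convex on $(0,\infty)$ for some $\rho>0$, and let $\mu_V$ be the equilibrium measure of $V$ on $[0,\infty)$. Then for any probability measure $\mu$ on $[0,\infty)$, $$\rho\,W^2(\mu,\mu_V)\le E_V(\mu)-E_V(\mu_V).$$ In the case $V(x)=rx-s\log(x)$ with $r>0$ and $s\ge0$, this inequality with $\rho=r$ is sharp.
   Context: For a probability measure $\mu$ on $[0,\infty)$, $$E_V(\mu)=\int V(x)\,\mu(dx)-\iint\log|x-y|\,\mu(dx)\mu(dy)$$ whenever both integrals exist and are finite, and $E_V(\mu)=+\infty$ otherwise (in particular when $\mu$ has atoms). $V$ is regarded as a lower semicontinuous function $[0,\infty)\to\mathbb{R}\cup\{+\infty\}$ with $\lim_{x\to\infty}(V(x)-2\log x)=\infty$; the equilibrium measure $\mu_V$ is the unique minimizer of $E_V$ over all probability measures on $[0,\infty)$, which is known to exist and to be compactly supported. For probability measures $\mu,\nu$ on $[0,\infty)$, $$W(\mu,\nu)=\inf_{\pi\in\Pi(\mu,\nu)}\left(\int(\sqrt{x}-\sqrt{y})^2\,\pi(dx,dy)\right)^{1/2},$$ where $\Pi(\mu,\nu)$ is the set of probability measures on $\mathbb{R}^2$ with marginals $\mu$ and $\nu$. *)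

(* Defs.v *)
From HB Require Import structures.
From mathcomp Require Import all_boot all_order all_algebra.
From mathcomp Require Import all_classical all_reals all_analysis.

Set Implicit Arguments.
Unset Strict Implicit.
Unset Printing Implicit Defensive.

Import Order.TTheory GRing.Theory Num.Theory.
Import numFieldNormedType.Exports.

Local Open Scope classical_set_scope.
Local Open Scope ring_scope.

(* Measures on [0, +oo[ are encoded as Borel measures on the real line that
   give no mass to ]-oo, 0[. *)
Notation probR R := (probability (measurableTypeR R) R).

Definition on_halfline (R : realType) (mu : probR R) : Prop :=
  mu `]-oo, 0[%classic = 0%E.

Definition C2_pos (R : realType) (V : R -> R) : Prop :=
  forall x : R, 0 < x ->
    [/\ derivable V x 1, derivable V^`()%classic x 1 &
        {for x, continuous V^`(2)%classic}].

Definition log_potential (R : realType) (r s x : R) : R := r * x - s * ln x.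

(* The potential on [0, +oo[ with values in ]-oo, +oo] determined by its values
   on ]0, +oo[: lower semicontinuous extension at 0.  The values of V on
   ]-oo, 0] are never used. *)
Definition lsc_ext (R : realType) (V : R -> R) (x : R) : \bar R :=
  if 0 < x then (V x)%:E else limf_einf (fun y => (V y)%:E) 0^'+.

Section energy.
Local Open Scope ereal_scope.

(* lne is the extended logarithm, lne 0 = -oo, so that the kernel is -oo on the
   diagonal and a measure with an atom has infinite energy. *)
Definition log_kernel (R : realType)
    (z : measurableTypeR R * measurableTypeR R) : \bar R :=
  lne `|z.1 - z.2|%:E.

Definition energy (R : realType) (V : R -> R) (mu : probR R) : \bar R :=
  if `[< mu.-integrable `[0%R, +oo[%classic (lsc_ext V) /\
         (mu \x mu).-integrable setT (@log_kernel R) >]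
  then \int[mu]_(x in `[0%R, +oo[%classic) lsc_ext V x
       - \int[mu \x mu]_z log_kernel z
  else +oo.

Definition is_equilibrium (R : realType) (V : R -> R) (muV : probR R) : Prop :=
  [/\ on_halfline muV,
      forall nu : probR R, on_halfline nu -> energy V muV <= energy V nu &
      forall nu : probR R, on_halfline nu ->
        (forall nu' : probR R, on_halfline nu' -> energy V nu <= energy V nu') ->
        forall A, measurable A -> nu A = muV A].

Definition coupling (R : realType) (mu nu : probR R)
    (pi : probability (measurableTypeR R * measurableTypeR R)%type R) : Prop :=
  (forall A, measurable A -> pi (fst @^-1` A) = mu A) /\
  (forall A, measurable A -> pi (snd @^-1` A) = nu A).

Definition transport_cost (R : realType)
    (pi : probability (measurableTypeR R * measurableTypeR R)%type R) : \bar R :=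
  \int[pi]_z ((Num.sqrt z.1 - Num.sqrt z.2) ^+ 2)%:E.

Definition W (R : realType) (mu nu : probR R) : \bar R :=
  ereal_inf [set sqrte (transport_cost pi) | pi in coupling mu nu].

End energy.

(* Main.v *)
Require Import Defs.
From HB Require Import structures.
From mathcomp Require Import all_boot all_order all_algebra.
From mathcomp Require Import all_classical all_reals all_analysis.
From mathcomp Require Import measurable_realfun ring lra.

Set Implicit Arguments.
Unset Strict Implicit.
Unset Printing Implicit Defensive.

Import Order.TTheory GRing.Theory Num.Theory.
Import numFieldNormedType.Exports.

Local Open Scope classical_set_scope.
Local Open Scope ring_scope.

(** The inequality is the strong displacement convexity of the energy, and no
    Euler-Lagrange equation is needed.  Write x = a^2, y = b^2 and interpolate
    by x_t = ((1 - t) a + t b)^2.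

    - Since V(a^2) - rho a^2 is convex,
      V(x_t) <= (1 - t) V(x) + t V(y) - rho t (1 - t) (a - b)^2
      ([convex_function_sqrt]).
    - In the square root coordinate |x - x'| = |a - a'| (a + a').  When (x, y)
      and (x', y') are ordered in the same way, both factors interpolate
      linearly, so concavity of ln gives
      ln |x_t - x'_t| >= (1 - t) ln |x - x'| + t ln |y - y'|
      ([lne_interp]).

    Realize muV and mu as the laws of their quantile functions on the unit
    interval ([quantile_law]): these are comonotone, and the law of the
    interpolated variable has energy at most
    (1 - t) E(muV) + t E(mu) - rho t (1 - t) C, where C is the cost of the
    quantile coupling ([rv_energy_interp]).  By minimality it is at least
    E(muV), hence rho (1 - t) C <= E(mu) - E(muV) for all 0 < t < 1; letting t
    tend to 0 and using W^2 <= C gives the claim ([transport_energy]).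

    Two preliminary points.  A measure of finite energy has no atom, because the
    kernel is -oo on the diagonal, so all quantiles are positive and the
    value of the potential at 0 is irrelevant.  The energy of muV is finite by
    uniqueness: otherwise every measure, in particular both Dirac masses at 0
    and at 1, would be a minimizer ([equilibrium_energy_lty]).

    For sharpness take mu to be the image of muV under x |-> th^2 x.  If m is
    the mean of muV, then W^2 >= (th - 1)^2 m ([W_scale_ge]) while the energy
    grows by at most r th^2 m ([rv_energy_scale_le]); letting th tend to
    infinity, an admissible constant rho satisfies rho <= r. *)

(** * Change of variables *)

Section law.
Context d1 d2 (T : measurableType d1) (Y : measurableType d2) (R : realType).
Variables (P : {measure set T -> \bar R}) (X : T -> Y).
Variable mu : {measure set Y -> \bar R}.
Hypothesis mX : measurable_fun [set: T] X.
Hypothesis muE : forall A, measurable A -> mu A = P (X @^-1` A).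
Local Open Scope ereal_scope.

Let Xmix := isMeasurableFun.Build _ _ _ _ _ mX.
Let Xpack : {mfun T >-> Y} := HB.pack X Xmix.

Variable D : set Y.
Hypotheses (mD : measurable D) (XD : forall x, D (X x)).

Let XDT : X @^-1` D = [set: T].
Proof. by apply/seteqP; split => x // _; exact: XD. Qed.

Let lawE f : \int[mu]_(y in D) f y = \int[pushforward P Xpack]_(y in D) f y.
Proof. by apply: eq_measure_integral => A mA _; rewrite muE. Qed.

Lemma ge0_integral_law (f : Y -> \bar R) : measurable_fun [set: Y] f ->
  (forall y, 0 <= f y) -> \int[mu]_(y in D) f y = \int[P]_x f (X x).
Proof.
move=> mf f0; rewrite lawE ge0_integral_pushforward ?XDT//.
exact: measurable_funTS.
Qed.

Lemma integrable_law (f : Y -> \bar R) : measurable_fun [set: Y] f ->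
  mu.-integrable D f <-> P.-integrable [set: T] (f \o X).
Proof.
move=> mf.
have E : \int[mu]_(y in D) `|f y| = \int[P]_x `|f (X x)|.
  by apply: ge0_integral_law => //; exact: measurableT_comp.
split => /integrableP[_ h]; apply/integrableP; split => //.
- exact: measurableT_comp.
- by rewrite /= -E.
- exact: measurable_funTS.
- by rewrite E.
Qed.

Lemma integral_law (f : Y -> \bar R) : measurable_fun [set: Y] f ->
  P.-integrable [set: T] (f \o X) ->
  \int[mu]_(y in D) f y = \int[P]_x f (X x).
Proof. by move=> mf fi; rewrite lawE integral_pushforward ?XDT. Qed.

End law.

(** The law of a pair of independent copies is the product of the laws. *)
Lemma law_prod d1 d2 (T : measurableType d1) (Y : measurableType d2)
    (R : realType) (P : probability T R) (X : T -> Y) (mu : probability Y R) :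
  measurable_fun [set: T] X ->
  (forall A, measurable A -> mu A = P (X @^-1` A)) ->
  forall A, measurable A ->
    (mu \x mu)%E A = (P \x P)%E ((fun z => (X z.1, X z.2)) @^-1` A).
Proof.
move=> mX muE A mA.
pose XX (z : T * T) := (X z.1, X z.2).
have mXX : measurable_fun [set: T * T] XX.
  by apply: measurable_fun_pair => /=; apply: measurableT_comp.
pose Xmix := isMeasurableFun.Build _ _ _ _ _ mXX.
pose Xpack : {mfun (T * T)%type >-> (Y * Y)%type} := HB.pack XX Xmix.
apply: (@product_measure_unique _ _ _ _ _ mu mu
          (pushforward (P \x P)%E Xpack)) => //= B C mB mC.
rewrite /pushforward /=.
have -> : XX @^-1` (B `*` C) = (X @^-1` B) `*` (X @^-1` C) by [].
rewrite product_measure1E ?muE//;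
  by rewrite -[X in measurable X]setTI; exact: mX.
Qed.

(** * Quantile functions *)

Section quantile.
Context (R : realType).
Implicit Types (mu : probR R) (u x : R).

(** Retraction onto the open unit interval, the outside being sent to 1/2.
    Composing with it makes quantile functions positive everywhere, and any two
    of them comonotone everywhere rather than almost everywhere. *)
Definition clip u : R := if (0 < u) && (u < 1) then u else 2^-1.

Lemma clip_gt0 u : 0 < clip u.
Proof. by rewrite /clip; case: ifP => [/andP[]//|_]; rewrite invr_gt0. Qed.

Lemma clip_lt1 u : clip u < 1.
Proof. by rewrite /clip; case: ifP => [/andP[]//|_]; rewrite invf_lt1// ltr1n. Qed.

Lemma measurable_clip : measurable_fun [set: R] clip.
Proof.
apply: measurable_fun_if => //=.
- by apply: measurable_and => /=; apply: measurable_fun_ltr.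
Qed.

(** The quantile function of mu, extended by its median outside of the open
    unit interval. *)
Definition quantile mu u : R :=
  inf [set x | ((clip u)%:E <= mu `]-oo, x]%classic)%E].

Section fixed_measure.
Variable mu : probR R.
Hypothesis mu_pos : mu `]-oo, 0]%classic = 0%E.

Let F x := mu `]-oo, x]%classic.

Let F_nd x y : x <= y -> (F x <= F y)%E.
Proof.
move=> xy; apply: le_measure; rewrite ?inE//.
by apply: subset_itvl; rewrite bnd_simp.
Qed.

Let F_rcont x u : (F x < u%:E)%E -> exists2 y, x < y & (F y < u%:E)%E.
Proof.
move=> Fxu.
pose G n := `]-oo, (x + n.+1%:R^-1)%R]%classic : set (measurableTypeR R).
have cvgF : mu (G n) @[n --> \oo] --> F x.
  have -> : F x = mu (\bigcap_n G n) by rewrite /G -itvNycEbigcap.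
  apply: nonincreasing_cvg_mu => [| | |m n mn].
  - by rewrite -ge0_fin_numE// fin_num_measure//; exact: measurable_itv.
  - by move=> ?; exact: measurable_itv.
  - by apply: bigcap_measurable => // k _; exact: measurable_itv.
  - apply/subsetPset; apply: subset_itvl.
    by rewrite bnd_simp lerD2l lef_pV2 ?posrE// ler_nat.
have [N _ /(_ N (leqnn N))/= FN] : \forall n \near \oo, (mu (G n) < u%:E)%E.
  by move: cvgF => /(_ [set z | (z < u%:E)%E]); apply; exact: open_ereal_lt'.
by exists (x + N.+1%:R^-1) => //; rewrite ltrDl invr_gt0.
Qed.

Let F_cvg1 u : u < 1 -> exists x, (u%:E <= F x)%E.
Proof.
move=> u1.
pose G n := `]-oo, n%:R]%classic : set (measurableTypeR R).
have cvgF : mu (G n) @[n --> \oo] --> 1%E.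
  have <- : mu (\bigcup_n G n) = 1%E.
    have -> : \bigcup_n G n = setT; last exact: probability_setT.
    rewrite -subTset => t _/=.
    by exists (Num.truncn t).+1 => //; rewrite /G /= in_itv/= ltW// truncnS_gt.
  apply: nondecreasing_cvg_mu.
  - by move=> k; exact: measurable_itv.
  - by apply: bigcup_measurable => k _; exact: measurable_itv.
  - move=> n m nm; apply/subsetPset; apply: subset_itvl.
    by rewrite bnd_simp ler_nat.
have [N _ /(_ N (leqnn N))/= FN] : \forall n \near \oo, (u%:E < mu (G n))%E.
  move: cvgF => /(_ [set z | (u%:E < z)%E]); apply; apply: open_ereal_gt'.
  by rewrite lte_fin.
by exists N%:R; exact: ltW.
Qed.

(** Galois connection between the quantile function and the distribution
    function. *)
Lemma quantile_le u x : (quantile mu u <= x) = ((clip u)%:E <= F x)%E.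
Proof.
set S := [set x | ((clip u)%:E <= F x)%E].
have lbS z : S z -> 0 < z.
  move=> Sz; rewrite ltNge; apply/negP => z0.
  have := le_trans Sz (F_nd z0).
  by rewrite /F mu_pos lee_fin leNgt clip_gt0.
apply/idP/idP; last first.
  by move=> Sx; apply: ge_inf => //; exists 0 => z /lbS /ltW.
move=> Qx; rewrite leNgt; apply/negP => /F_rcont[y xy Fy].
have : y <= quantile mu u.
  apply: lb_le_inf; first exact: F_cvg1 (clip_lt1 u).
  move=> z Sz; rewrite leNgt; apply/negP => zy.
  have := le_trans Sz (F_nd (ltW zy)).
  by rewrite leNgt Fy.
by rewrite leNgt (le_lt_trans Qx xy).
Qed.

Lemma quantile_gt0 u : 0 < quantile mu u.
Proof.
by rewrite ltNge quantile_le /F mu_pos lee_fin -ltNge clip_gt0.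
Qed.

Lemma quantile_nd u v : clip u <= clip v -> quantile mu u <= quantile mu v.
Proof.
move=> uv; rewrite quantile_le.
by apply: (@le_trans _ _ (clip v)%:E); rewrite ?lee_fin// -quantile_le.
Qed.

Lemma measurable_quantile :
  measurable_fun [set: measurableTypeR R] (quantile mu : measurableTypeR R -> R).
Proof.
apply: (measurability _ (RGenOInfty.measurableE R)) => //.
move=> _ [_ [x ->] <-]; rewrite setTI.
rewrite [X in measurable X](_ : _ = clip @^-1` `]fine (F x), +oo[%classic).
  rewrite -[X in measurable X]setTI.
  by apply: measurable_clip => //; exact: measurable_itv.
have FE u : (quantile mu u <= x) = (clip u <= fine (F x)).
  by rewrite quantile_le -lee_fin fineK// fin_num_measure.
by apply/seteqP; split => u /=; rewrite !in_itv /= !andbT !ltNge FE.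
Qed.

End fixed_measure.
End quantile.

Lemma uniform_clip (R : realType) (c : R) : 0 <= c -> c <= 1 ->
  uniform_prob (@ltr01 R) (@clip R @^-1` `]-oo, c]%classic) = c%:E.
Proof.
move=> c0 c1.
set U := _ @^-1` _.
have mU : measurable U.
  rewrite -[X in measurable X]setTI.
  by apply: measurable_clip => //; exact: measurable_itv.
rewrite /uniform_prob integral_uniform_pdf.
rewrite (eq_integral (fun=> 1%:E)); last first.
  by move=> x; rewrite inE /= in_itv /= /uniform_pdf => -[_ ->]; rewrite subr0 invr1.
have mU01 : measurable (U `&` `[0, 1]%classic).
  by apply: measurableI => //; exact: measurable_itv.
rewrite integral_cst//= mul1e; apply/eqP; rewrite eq_le; apply/andP; split.
  have -> : c%:E = (lebesgue_measure (`[0%R, c] : set R) +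
                   lebesgue_measure ([set 1%R] : set R))%E.
    rewrite lebesgue_measure_set1 adde0 lebesgue_measure_itv/= lte_fin.
    by move: c0; rewrite le_eqVlt => /predU1P[<-|->]; rewrite ?ltxx ?sube0.
  apply: le_trans; last exact: measureU2.
  apply: le_measure; rewrite ?inE//; first exact: measurableU.
  move=> u []; rewrite /U /= /clip !in_itv /= => + /andP[u0 u1].
  have [->|un1] := eqVneq u 1; first by right.
  have [->|un0] := eqVneq u 0; first by left; rewrite lexx c0.
  have -> : 0 < u by rewrite lt_neqAle eq_sym un0.
  have -> : u < 1 by rewrite lt_neqAle un1.
  by left; rewrite u0.
have -> : c%:E = lebesgue_measure (`]0%R, c[ : set R).
  rewrite lebesgue_measure_itv/= lte_fin.
  by move: c0; rewrite le_eqVlt => /predU1P[<-|->]; rewrite ?ltxx ?sube0.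
apply: le_measure; rewrite ?inE//.
move=> u /=; rewrite in_itv /= => /andP[u0 uc].
have u1 := lt_le_trans uc c1.
split; first by rewrite /U /= in_itv /= /clip u0 u1 /= ltW.
by rewrite /= in_itv /= !ltW.
Qed.

(** The uniform distribution on the unit interval. *)
Definition unit_uniform (R : realType) : probR R := uniform_prob (@ltr01 R).

(** Every law on the positive half-line is the image of the uniform law under
    its quantile function. *)
Lemma quantile_law (R : realType) (mu : probR R) : mu `]-oo, 0]%classic = 0%E ->
  forall A, measurable A -> mu A = unit_uniform R (quantile mu @^-1` A).
Proof.
move=> mu_pos.
have mQ : measurable_fun [set: measurableTypeR R]
    (quantile mu : measurableTypeR R -> measurableTypeR R).
  exact: measurable_quantile.
pose Qmix := isMeasurableFun.Build _ _ _ _ _ mQ.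
pose Q : {mfun measurableTypeR R >-> measurableTypeR R} := HB.pack (quantile mu) Qmix.
pose P := unit_uniform R.
have cdfE x : mu `]-oo, x]%classic = P (quantile mu @^-1` `]-oo, x]%classic).
  set F := mu `]-oo, x]%classic.
  have Ffin : F \is a fin_num by rewrite fin_num_measure//; exact: measurable_itv.
  rewrite [X in P X](_ : _ = @clip R @^-1` `]-oo, fine F]%classic).
    rewrite -[LHS]fineK//; apply/esym/uniform_clip.
      by apply: fine_ge0; exact: measure_ge0.
    by rewrite -lee_fin fineK//; apply: probability_le1; exact: measurable_itv.
  have FE u : (quantile mu u <= x) = (clip u <= fine F).
    by rewrite quantile_le// -lee_fin fineK.
  by apply/seteqP; split => u /=; rewrite !in_itv /= FE.
move=> A; apply: (@measure_unique _ R (measurableTypeR R) (@RGenOInfty.G R)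
   (fun n => `](- n%:R), +oo[%classic) _ _ _ _
   mu (pushforward P Q) _ _ A).
- exact: RGenOInfty.measurableE.
- move=> _ _ [x ->] [y ->]; exists (Num.max x y).
  by apply/seteqP; split => z /=; rewrite !in_itv /= !andbT gt_max => /andP.
- by move=> n; exists (- n%:R).
- rewrite -subTset => t _; exists (Num.truncn `|t|).+1 => //=.
  by rewrite in_itv /= andbT ltrNl (le_lt_trans (ler_norm _))// normrN truncnS_gt.
- move=> _ [x ->]; rewrite -setCitvl /pushforward /= preimage_setC.
  have mI : measurable (`]-oo, x]%classic : set (measurableTypeR R)).
    exact: measurable_itv.
  have mQI : measurable (quantile mu @^-1` `]-oo, x]%classic : set (measurableTypeR R)).
    by rewrite -[X in measurable X]setTI; exact: (measurable_quantile mu_pos).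
  by rewrite (probability_setC mu mI) cdfE; exact: (esym (probability_setC P mQI)).
- by move=> n; rewrite ltey_eq fin_num_measure//; exact: measurable_itv.
Qed.

(** * Energy of the law of a positive random variable *)

Lemma measurable_lne_EFin (R : realType) :
  measurable_fun [set: R] (fun x : R => lne x%:E).
Proof.
rewrite /lne; apply: measurable_fun_ifT => //=.
- exact: measurable_fun_ler.
- by apply/measurable_EFinP; exact: measurable_ln.
Qed.

Lemma measurable_lsc_ext (R : realType) (V : R -> R) :
  measurable_fun (`]0, +oo[%classic : set R) V -> measurable_fun [set: R] (lsc_ext V).
Proof.
move=> mV; apply: measurable_fun_if => //=.
- exact: measurable_fun_ltr.
- rewrite setTI; apply/measurable_EFinP.
  rewrite [X in measurable_fun X](_ : _ = `]0, +oo[%classic)//.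
  by apply/seteqP; split => x /=; rewrite in_itv /= andbT.
Qed.

Section energy_law.
Context d (T : measurableType d) (R : realType).
Variables (P : probability T R) (V : R -> R).
Hypothesis mV : measurable_fun (`]0, +oo[%classic : set R) V.
Local Open Scope ereal_scope.

(** The potential evaluated at a (positive) random variable. *)
Definition potential (X : T -> R) (x : T) : \bar R := (V (X x))%:E.

(** The logarithmic kernel evaluated at two independent copies of X. *)
Definition log_interaction (X : T -> R) (z : T * T) : \bar R :=
  lne `|X z.1 - X z.2|%:E.

(** The law of X has finite energy; see [energy_law_lty]. *)
Definition finite_energy (X : T -> R) : Prop :=
  P.-integrable [set: T] (potential X) /\
  (P \x P).-integrable [set: T * T] (log_interaction X).

Section random_variable.
Variable X : T -> R.
Hypotheses (mX : measurable_fun [set: T] X) (X_gt0 : forall x, (0 < X x)%R).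
Variable mu : probR R.
Hypothesis muE : forall A, measurable A -> mu A = P (X @^-1` A).

Lemma measurable_log_interaction : measurable_fun [set: T * T] (log_interaction X).
Proof.
apply: (@measurableT_comp _ _ _ _ _ _ (fun x : R => lne x%:E)).
  exact: measurable_lne_EFin.
by apply: measurableT_comp => //; apply: measurable_funB => /=; apply: measurableT_comp.
Qed.

Let potentialE : lsc_ext V \o X = potential X.
Proof. by apply/funext => x; rewrite /lsc_ext /potential /= X_gt0. Qed.

Let mXR : measurable_fun [set: T] (X : T -> measurableTypeR R) := mX.

Let log_kernelE : log_kernel (R:=R) \o (fun z : T * T => (X z.1, X z.2)) = log_interaction X.
Proof. by []. Qed.

Let mlog : measurable_fun [set: measurableTypeR R * measurableTypeR R] (@log_kernel R).
Proof.
apply: (@measurableT_comp _ _ _ _ _ _ (fun x : R => lne x%:E)).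
  exact: measurable_lne_EFin.
apply: measurableT_comp => //.
by apply: measurable_funB => /=; [exact: measurable_fst | exact: measurable_snd].
Qed.

Let mXX : measurable_fun [set: T * T]
  (fun z => (X z.1, X z.2) : measurableTypeR R * measurableTypeR R).
Proof. by apply: measurable_fun_pair => /=; apply: measurableT_comp. Qed.

Let muXX := law_prod mXR muE.

Let mI : measurable (`[0%R, +oo[%classic : set (measurableTypeR R)).
Proof. exact: measurable_itv. Qed.

Let XI x : `[0%R, +oo[%classic (X x).
Proof. by rewrite /= in_itv /= andbT ltW. Qed.

Let mL : measurable_fun [set: measurableTypeR R] (lsc_ext V).
Proof. exact: measurable_lsc_ext. Qed.

Let finite_energyE :
  (mu.-integrable `[0%R, +oo[%classic (lsc_ext V) /\
   (mu \x mu).-integrable setT (@log_kernel R)) <-> finite_energy X.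
Proof.
rewrite /finite_energy -potentialE -log_kernelE.
have i1 := integrable_law mXR muE mI XI mL.
have i2 := integrable_law mXX muXX measurableT (fun=> Logic.I) mlog.
by split => -[/i1 ? /i2 ?].
Qed.

Lemma energy_law : finite_energy X ->
  energy V mu = \int[P]_x potential X x - \int[P \x P]_z log_interaction X z.
Proof.
move=> fX; rewrite /energy; case: asboolP => [_|/finite_energyE//].
have [iV iK] := fX.
rewrite (integral_law mXR muE mI XI mL); last by rewrite potentialE.
rewrite (integral_law mXX muXX measurableT (fun=> Logic.I) mlog); last first.
  by rewrite log_kernelE.
congr (_ - _).
by apply: eq_integral => x _; rewrite -potentialE.
Qed.

Lemma energy_law_lty : energy V mu < +oo <-> finite_energy X.
Proof.
rewrite /energy; case: asboolP => h; last first.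
  by split => // fX; exfalso; apply: h; exact/finite_energyE.
split => _; first exact/finite_energyE.
have [h1 h2] := h.
by rewrite ltey_eq fin_numB !integrable_fin_num.
Qed.

Lemma energy_law_finite : finite_energy X -> energy V mu \is a fin_num.
Proof.
move=> fX; have [h1 h2] := fX.
by rewrite energy_law// fin_numB !integrable_fin_num.
Qed.

End random_variable.
End energy_law.

(** * Measures of finite energy *)

Lemma finite_energy_atomless (R : realType) (V : R -> R) (mu : probR R) (x : R) :
  (energy V mu < +oo)%E -> mu [set x] = 0%E.
Proof.
rewrite /energy; case: asboolP => [[_ iK] _|//].
have /= := integrable_ae measurableT iK.
move=> [N [mN N0 sN]].
have mx : measurable ([set x] : set (measurableTypeR R)) by exact: measurable_set1.
have : (mu \x mu)%E ([set x] `*` [set x]) = 0%E.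
  apply/eqP; rewrite -measure_le0 -N0; apply: le_measure; rewrite ?inE//.
    exact: measurableX.
  move=> [a b] [/= -> ->]; apply: sN => /= /(_ Logic.I).
  have -> : log_kernel (x, x) = -oo%E :> \bar R => //.
  by rewrite /log_kernel [(x, x).1]/= subrr normr0 le0_lneNy.
rewrite product_measure1E// => /eqP.
by rewrite mule_eq0 => /orP[] /eqP.
Qed.

Lemma finite_energy_pos (R : realType) (V : R -> R) (mu : probR R) :
  on_halfline mu -> (energy V mu < +oo)%E -> mu `]-oo, 0]%classic = 0%E.
Proof.
move=> mu0 /finite_energy_atomless-/(_ 0) mu1.
have mI : measurable (`]-oo, 0%R[%classic : set (measurableTypeR R)).
  exact: measurable_itv.
have m1 : measurable ([set 0%R] : set (measurableTypeR R)) by exact: measurable_set1.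
have -> : `]-oo, 0%R]%classic = `]-oo, 0%R[%classic `|` [set 0%R] :> set R.
  apply/seteqP; split => x /=; rewrite !in_itv /=.
    by rewrite le_eqVlt => /predU1P[->|]; [right|left].
  by case=> [/ltW//|->].
apply/eqP; rewrite -measure_le0.
apply: le_trans (measureU2 _ mI m1) _; rewrite -[leRHS]adde0.
by apply: leeD; rewrite measure_le0; apply/eqP; [exact: mu0|exact: mu1].
Qed.

(** If the minimum were +oo, all measures would be minimizers, which contradicts
    uniqueness. *)
Lemma equilibrium_energy_lty (R : realType) (V : R -> R) (muV : probR R) :
  is_equilibrium V muV -> (energy V muV < +oo)%E.
Proof.
move=> [hV minV uniqV]; rewrite ltey; apply/eqP => EV.
have E nu : on_halfline nu -> energy V nu = +oo%E.
  by move=> /minV; rewrite EV leye_eq => /eqP.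
have half (a : R) : 0 <= a -> on_halfline (\d_ (a : measurableTypeR R) : probR R).
  move=> a0; rewrite /on_halfline /= diracE memNset//=.
  by rewrite in_itv /= ltNge a0.
have U (a : R) : 0 <= a -> (\d_ (a : measurableTypeR R) : probR R) [set 0] = muV [set 0].
  move=> a0; apply: uniqV; first exact: half.
    by move=> nu /E ->; rewrite leey.
  exact: measurable_set1.
have n1 : ~ [set 0 : R] 1 by move=> /eqP; rewrite oner_eq0.
have : (\d_ (0 : measurableTypeR R) [set 0] : \bar R) = \d_ (1 : measurableTypeR R) [set 0].
  exact: etrans (U 0 (lexx _)) (esym (U 1 ler01)).
by rewrite !diracE mem_set// memNset//= => /eqP; rewrite eqe oner_eq0.
Qed.

(** * Displacement interpolation *)

Section interp.
Context (R : realType).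
Implicit Types (V : R -> R) (t x y rho : R).

(** Geodesic between x and y for the distance |sqrt x - sqrt y|. *)
Definition interp t x y : R := ((1 - t) * Num.sqrt x + t * Num.sqrt y) ^+ 2.

(** V is rho-uniformly convex along the geodesics [interp]: this is the
    convexity of a |-> V(a^2) - rho a^2, as an inequality for V. *)
Definition sqrt_uniformly_convex V rho := forall t x y : R,
  0 <= t -> t <= 1 -> 0 < x -> 0 < y ->
  V (interp t x y) + rho * (t * (1 - t) * (Num.sqrt x - Num.sqrt y) ^+ 2)
    <= (1 - t) * V x + t * V y.

Lemma interp_gt0 t x y : 0 <= t -> t <= 1 -> 0 < x -> 0 < y -> 0 < interp t x y.
Proof.
move=> t0 t1 x0 y0; rewrite exprn_gt0//.
have sx : 0 < Num.sqrt x by rewrite sqrtr_gt0.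
have sy : 0 < Num.sqrt y by rewrite sqrtr_gt0.
by nra.
Qed.

Lemma interp_le t x y : 0 <= t -> t <= 1 -> 0 <= x -> 0 <= y ->
  interp t x y <= x + y.
Proof.
move=> t0 t1 x0 y0; rewrite /interp.
rewrite -[leRHS](_ : Num.sqrt x ^+ 2 + Num.sqrt y ^+ 2 = _); last by rewrite !sqr_sqrtr.
move: (Num.sqrt x) (Num.sqrt y) => a b; rewrite -subr_ge0.
have -> : a ^+ 2 + b ^+ 2 - ((1 - t) * a + t * b) ^+ 2
  = t * (1 - t) * (a - b) ^+ 2 + t * a ^+ 2 + (1 - t) * b ^+ 2 by ring.
have t1' : 0 <= 1 - t by rewrite subr_ge0.
by apply: addr_ge0; [apply: addr_ge0|]; apply: mulr_ge0; rewrite ?sqr_ge0// mulr_ge0.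
Qed.

Lemma convex_function_sqrt V rho :
  convex_function (`]0, +oo[%classic : set R^o)
       (fun x : R^o => V (x ^+ 2) - rho * x ^+ 2) ->
  sqrt_uniformly_convex V rho.
Proof.
move=> cV t x y t0 t1 x0 y0.
have sx : 0 < Num.sqrt x by rewrite sqrtr_gt0.
have sy : 0 < Num.sqrt y by rewrite sqrtr_gt0.
have t01 : 0 <= 1 - t <= 1 by rewrite subr_ge0 t1 gerBl.
pose T01 : {i01 R} := Itv01 (andP t01).1 (andP t01).2.
have convE (a b : R) : (1 - t) * a + (1 - (1 - t)) * b = (1 - t) * a + t * b.
  by rewrite subKr.
have := cV T01 (Num.sqrt x) (Num.sqrt y).
rewrite !inE /= !in_itv /= !andbT => /(_ sx sy) H.
have {H} : V (((1 - t) * Num.sqrt x + (1 - (1 - t)) * Num.sqrt y) ^+ 2) -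
    rho * ((1 - t) * Num.sqrt x + (1 - (1 - t)) * Num.sqrt y) ^+ 2 <=
    (1 - t) * (V (Num.sqrt x ^+ 2) - rho * Num.sqrt x ^+ 2) +
    (1 - (1 - t)) * (V (Num.sqrt y ^+ 2) - rho * Num.sqrt y ^+ 2) by exact: H.
rewrite !convE sqr_sqrtr ?(ltW x0)// sqr_sqrtr ?(ltW y0)// /interp.
rewrite -[in rho * x](sqr_sqrtr (ltW x0)) -[in rho * y](sqr_sqrtr (ltW y0)).
move: (Num.sqrt x) (Num.sqrt y) => a b.
have -> : (1 - t) * (V x - rho * a ^+ 2) + t * (V y - rho * b ^+ 2)
        = (1 - t) * V x + t * V y - rho * ((1 - t) * a ^+ 2 + t * b ^+ 2) by ring.
have -> : rho * ((1 - t) * a ^+ 2 + t * b ^+ 2)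
  = rho * (t * (1 - t) * (a - b) ^+ 2) + rho * ((1 - t) * a + t * b) ^+ 2 by ring.
lra.
Qed.

(** The convex function f(a) = V(a^2) - rho a^2 is bounded below by an affine
    function, so V(x) grows at least linearly.  This makes means finite. *)
Lemma sqrt_uniformly_convex_coercive V rho : 0 < rho ->
  sqrt_uniformly_convex V rho ->
  exists C, forall x, 0 < x -> rho / 2 * x <= V x + C.
Proof.
move=> rho0 cV.
pose f a := V (a ^+ 2) - rho * a ^+ 2.
have cf t a b : 0 <= t -> t <= 1 -> 0 < a -> 0 < b ->
    f ((1 - t) * a + t * b) <= (1 - t) * f a + t * f b.
  move=> t0 t1 a0 b0.
  have a2 : 0 < a ^+ 2 by rewrite exprn_gt0.
  have b2 : 0 < b ^+ 2 by rewrite exprn_gt0.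
  have := cV t (a ^+ 2) (b ^+ 2) t0 t1 a2 b2.
  rewrite /interp !sqrtr_sqr !gtr0_norm// /f.
  move: (V _) (V (a ^+ 2)) (V (b ^+ 2)) => v vx vy.
  nra.
pose M := 3 * (`|f 1| + `|f 2| + `|f 3|).
have M0 : 0 <= M by rewrite mulr_ge0// !addr_ge0.
have fM a : 0 < a -> - (M * (1 + a)) <= f a.
  move=> a0.
  have := ler_norm (f 1); have := ler_norm (- f 1); rewrite normrN => h1 h2.
  have := ler_norm (f 2); have := ler_norm (- f 2); rewrite normrN => h3 h4.
  have := ler_norm (f 3); have := ler_norm (- f 3); rewrite normrN => h5 h6.
  rewrite /M; have [a2|a2] := leP a 2.
    (* 2 lies between a and 3: f(a) is above the chord from 2 to 3 *)
    have d0 : 0 < 3 - a by lra.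
    have := @cf ((2 - a) / (3 - a)) a 3.
    have -> : (1 - (2 - a) / (3 - a)) * a + (2 - a) / (3 - a) * 3 = 2 :> R.
      by field; rewrite gt_eqF.
    rewrite divr_ge0 ?ler_pdivrMr//; [|lra..].
    have -> : 1 - (2 - a) / (3 - a) = (3 - a)^-1 by field; rewrite gt_eqF.
    move=> /(_ isT) H.
    have : (3 - a) * f 2 <= f a + (2 - a) * f 3.
      have -> : f a + (2 - a) * f 3 = (3 - a) * ((3 - a)^-1 * f a + (2 - a) / (3 - a) * f 3).
        by field; rewrite gt_eqF.
      rewrite ler_pM2l//; apply: H => //; lra.
    nra.
  (* 2 lies between 1 and a: f(a) is above the chord from 1 to 2 *)
  have d0 : 0 < a - 1 by lra.
  have := @cf ((a - 1)^-1) 1 a.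
  have -> : (1 - (a - 1)^-1) * 1 + (a - 1)^-1 * a = 2 :> R.
    by field; rewrite gt_eqF.
  rewrite invr_ge0 (ltW d0) invf_le1// => /(_ isT) H.
  have : (a - 1) * f 2 <= (a - 2) * f 1 + f a.
    have -> : (a - 2) * f 1 + f a = (a - 1) * ((1 - (a - 1)^-1) * f 1 + (a - 1)^-1 * f a).
      by field; rewrite gt_eqF.
    rewrite ler_pM2l//; apply: H => //; lra.
  nra.
exists (M + M ^+ 2 / (2 * rho)) => x x0.
have := fM (Num.sqrt x); rewrite sqrtr_gt0 /f (sqr_sqrtr (ltW x0)) => /(_ x0) H.
have E : rho / 2 * x - M * Num.sqrt x + M ^+ 2 / (2 * rho)
       = rho / 2 * (Num.sqrt x - M / rho) ^+ 2.
  rewrite -{1}(sqr_sqrtr (ltW x0)); field.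
  by rewrite gt_eqF.
have : 0 <= rho / 2 * (Num.sqrt x - M / rho) ^+ 2.
  by rewrite mulr_ge0 ?sqr_ge0// divr_ge0 ?ltW.
rewrite -E; move: (M ^+ 2 / _) H => m.
rewrite mulrDr mulr1.
move: (M * _) => Ma; lra.
Qed.

Lemma ln_conv t x y : 0 <= t -> t <= 1 -> 0 < x -> 0 < y ->
  (1 - t) * ln x + t * ln y <= ln ((1 - t) * x + t * y).
Proof.
move=> t0 t1 x0 y0.
have t01 : 0 <= 1 - t <= 1 by rewrite subr_ge0 t1 gerBl.
pose T01 : {i01 R} := Itv01 (andP t01).1 (andP t01).2.
by have := concave_ln T01 x0 y0; rewrite !convRE /= /unstable.onem subKr.
Qed.

(** Concavity of the logarithmic kernel along comonotone interpolation.  Both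
    sides may be -oo, on the diagonal. *)
Lemma lne_interp t x0 x1 y0 y1 : 0 < t -> t < 1 ->
  0 < x0 -> 0 < x1 -> 0 < y0 -> 0 < y1 -> 0 <= (x0 - y0) * (x1 - y1) ->
  ((1 - t)%:E * lne `|x0 - y0|%:E + t%:E * lne `|x1 - y1|%:E <=
   lne `|interp t x0 x1 - interp t y0 y1|%:E)%E.
Proof.
wlog : x0 x1 y0 y1 / y0 <= x0 => [WL|].
  have [h|/ltW h] := leP y0 x0; first exact: WL.
  move=> t0 t1 x00 x10 y00 y10 c.
  have := WL y0 y1 x0 x1 h t0 t1 y00 y10 x00 x10.
  rewrite (distrC y0) (distrC y1) (distrC (interp t y0 y1)); apply.
  by rewrite -mulrNN !opprB.
move=> yx0 t0 t1 x00 x10 y00 y10 c.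
have [e0|n0] := eqVneq x0 y0.
  rewrite e0 subrr normr0 [X in (_ * X + _)%E]le0_lneNy//.
  rewrite gt0_muleNy ?lte_fin ?subr_gt0//.
  by rewrite addNye ?leNye//.
have [e1|n1] := eqVneq x1 y1.
  rewrite e1 subrr normr0 [X in (_ + _ * X)%E]le0_lneNy//.
  rewrite gt0_muleNy ?lte_fin ?subr_gt0//.
  by rewrite addeNy ?leNye//.
have lt0 : y0 < x0 by rewrite lt_neqAle eq_sym n0.
have lt1 : y1 < x1.
  rewrite lt_neqAle eq_sym n1 /=.
  by move: c; rewrite pmulr_rge0 ?subr_gt0// subr_ge0.
have a0 : 0 < Num.sqrt x0 by rewrite sqrtr_gt0.
have b0 : 0 < Num.sqrt x1 by rewrite sqrtr_gt0.
have c0 : 0 < Num.sqrt y0 by rewrite sqrtr_gt0.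
have d0 : 0 < Num.sqrt y1 by rewrite sqrtr_gt0.
have ac : Num.sqrt y0 < Num.sqrt x0 by rewrite ltr_sqrt.
have bd : Num.sqrt y1 < Num.sqrt x1 by rewrite ltr_sqrt.
rewrite -{1}(sqr_sqrtr (ltW x00)) -{1}(sqr_sqrtr (ltW x10)).
rewrite -{1}(sqr_sqrtr (ltW y00)) -{1}(sqr_sqrtr (ltW y10)) /interp.
move: (Num.sqrt x0) (Num.sqrt x1) (Num.sqrt y0) (Num.sqrt y1) a0 b0 c0 d0 ac bd.
move=> a b u v a0 b0 u0 v0 ua vb.
(* each of the two factors of the difference is a convex combination *)
have -> : ((1 - t) * a + t * b) ^+ 2 - ((1 - t) * u + t * v) ^+ 2 =
  ((1 - t) * (a - u) + t * (b - v)) * ((1 - t) * (a + u) + t * (b + v)) by ring.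
have t1' : 0 < 1 - t by rewrite subr_gt0.
have p1 : 0 < a - u by rewrite subr_gt0.
have p2 : 0 < b - v by rewrite subr_gt0.
have p3 : 0 < a + u by rewrite addr_gt0.
have p4 : 0 < b + v by rewrite addr_gt0.
have q1 : 0 < (1 - t) * (a - u) + t * (b - v) by rewrite addr_gt0 ?mulr_gt0.
have q2 : 0 < (1 - t) * (a + u) + t * (b + v) by rewrite addr_gt0 ?mulr_gt0.
rewrite !subr_sqr !gtr0_norm ?mulr_gt0//.
rewrite !lne_EFin ?mulr_gt0// -!EFinM -EFinD lee_fin !lnM ?posrE//.
have := ln_conv (ltW t0) (ltW t1) p1 p2; have := ln_conv (ltW t0) (ltW t1) p3 p4.
lra.
Qed.

Lemma lne_dist_le x y : 0 < x -> 0 < y -> (lne `|x - y|%:E <= (x + y)%:E)%E.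
Proof.
move=> x0 y0; have [/eqP|n0] := eqVneq `|x - y| 0.
  by move=> /eqP ->; rewrite le0_lneNy ?leNye.
have p : 0 < `|x - y| by rewrite lt_neqAle eq_sym n0 normr_ge0.
rewrite lne_EFin// lee_fin (le_trans (ltW (ln_sublinear p)))//.
by rewrite (le_trans (ler_normB _ _))// !gtr0_norm.
Qed.

End interp.

Lemma conv_norm_le (R : realType) (t a b : R) : 0 <= t -> t <= 1 ->
  `|(1 - t) * a + t * b| <= `|a| + `|b|.
Proof.
move=> t0 t1; apply: le_trans (ler_normD _ _) _.
have t1' : 0 <= 1 - t by rewrite subr_ge0.
rewrite !normrM (ger0_norm t0) (ger0_norm t1').
by apply: lerD; rewrite ler_piMl// gerBl.
Qed.

(** * Displacement convexity of the energy *)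

Section displacement_convexity.
Context d (T : measurableType d) (R : realType).
Variables (P : probability T R) (V : R -> R) (rho : R).
Hypothesis mV : measurable_fun (`]0, +oo[%classic : set R) V.
Hypotheses (rho0 : 0 < rho) (cV : sqrt_uniformly_convex V rho).
Local Open Scope ereal_scope.

(** The energy of the law of X; see [energy_law]. *)
Definition rv_energy (X : T -> R) : \bar R :=
  \int[P]_x potential V X x - \int[P \x P]_z log_interaction X z.

(** The transport cost of the coupling of the laws of X and Y given by (X, Y). *)
Definition rv_cost (X Y : T -> R) : \bar R :=
  \int[P]_x ((Num.sqrt (X x) - Num.sqrt (Y x)) ^+ 2)%:E.

Lemma measurable_potential (X : T -> R) : measurable_fun [set: T] X ->
  (forall x, (0 < X x)%R) -> measurable_fun [set: T] (potential V X).
Proof.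
move=> mX X0.
have -> : potential V X = lsc_ext V \o X.
  by apply/funext => x; rewrite /lsc_ext /potential /= X0.
by apply: measurableT_comp mX; exact: measurable_lsc_ext.
Qed.

Lemma measurable_sqrt : measurable_fun [set: R] (@Num.sqrt R).
Proof. by apply: continuous_measurable_fun; exact: sqrt_continuous. Qed.

Lemma finite_energy_mean (X : T -> R) : measurable_fun [set: T] X ->
  (forall x, (0 < X x)%R) -> finite_energy P V X ->
  P.-integrable [set: T] (EFin \o X).
Proof.
move=> mX X0 [iV _].
have [C HC] := sqrt_uniformly_convex_coercive rho0 cV.
have iC : P.-integrable [set: T] (fun x => `|potential V X x| + (`|C|)%:E).
  apply: integrableD => //; first exact: integrable_abse.
  exact: finite_measure_integrable_cst.
have := integrableZl measurableT (2 / rho) iC.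
apply: le_integrable => //; first exact/measurable_EFinP.
move=> x _ /=; rewrite lee_fin.
rewrite (gtr0_norm (X0 x)); apply: le_trans (ler_norm _).
rewrite mulrAC ler_pdivlMr// -ler_pdivrMl//.
have := HC _ (X0 x); have := ler_norm (V (X x)); have := ler_norm C.
lra.
Qed.

Lemma integrable_fst (f : T -> \bar R) : P.-integrable [set: T] f ->
  (P \x P).-integrable [set: T * T] (f \o fst).
Proof.
move=> fi.
have mf := measurable_int P fi.
apply: (iffLR (@integrable_law _ _ _ _ _ (P \x P)%E fst P measurable_fst _
  setT measurableT (fun=> Logic.I) f mf)) => // A mA.
have -> : fst @^-1` A = A `*` [set: T] by apply/seteqP; split => -[a b] //= [].
rewrite -[LHS]mule1 -(probability_setT P).
by apply/esym/product_measure1E.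
Qed.

Lemma integrable_snd (f : T -> \bar R) : P.-integrable [set: T] f ->
  (P \x P).-integrable [set: T * T] (f \o snd).
Proof.
move=> fi.
have mf := measurable_int P fi.
apply: (iffLR (@integrable_law _ _ _ _ _ (P \x P)%E snd P measurable_snd _
  setT measurableT (fun=> Logic.I) f mf)) => // A mA.
have -> : snd @^-1` A = [set: T] `*` A by apply/seteqP; split => -[a b] //= [].
rewrite -[LHS]mul1e -(probability_setT P).
by apply/esym/product_measure1E.
Qed.

Section comonotone.
Variables X0 X1 : T -> R.
Hypotheses (mX0 : measurable_fun [set: T] X0) (mX1 : measurable_fun [set: T] X1).
Hypotheses (X0_gt0 : forall x, (0 < X0 x)%R) (X1_gt0 : forall x, (0 < X1 x)%R).
Hypothesis X01 : forall u v, (0 <= (X0 u - X0 v) * (X1 u - X1 v))%R.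
Hypotheses (fX0 : finite_energy P V X0) (fX1 : finite_energy P V X1).

Let iX0 := finite_energy_mean mX0 X0_gt0 fX0.
Let iX1 := finite_energy_mean mX1 X1_gt0 fX1.

Lemma rv_cost_integrable :
  P.-integrable [set: T] (fun x => ((Num.sqrt (X0 x) - Num.sqrt (X1 x)) ^+ 2)%:E).
Proof.
apply: le_integrable (integrableD measurableT iX0 iX1) => //.
  apply/measurable_EFinP; apply: measurable_funX; apply: measurable_funB;
  by apply: measurableT_comp => //; exact: measurable_sqrt.
move=> x _ /=; rewrite lee_fin ger0_norm ?sqr_ge0//.
apply: le_trans (ler_norm _).
rewrite -{2}(sqr_sqrtr (ltW (X0_gt0 x))) -{2}(sqr_sqrtr (ltW (X1_gt0 x))).
have := sqrtr_ge0 (X0 x); have := sqrtr_ge0 (X1 x).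
by nra.
Qed.

Section fixed_t.
Variable t : R.
Hypotheses (t0 : (0 < t)%R) (t1 : (t < 1)%R).

Let Xt x := interp t (X0 x) (X1 x).

Let Xt_gt0 x : (0 < Xt x)%R.
Proof. by rewrite interp_gt0// ltW. Qed.

Lemma measurable_interp : measurable_fun [set: T] Xt.
Proof.
apply: measurable_funX; apply: measurable_funD; apply: measurable_funM => //;
by apply: measurableT_comp => //; exact: measurable_sqrt.
Qed.

Let iV0 := fX0.1.
Let iV1 := fX1.1.
Let iK0 := fX0.2.
Let iK1 := fX1.2.

Lemma finite_energy_interp : finite_energy P V Xt.
Proof.
split.
  have [C HC] := sqrt_uniformly_convex_coercive rho0 cV.
  have iC := finite_measure_integrable_cst P (`|C|) measurableT.
  have := integrableD measurableT
    (integrableD measurableT (integrable_abse iV0) (integrable_abse iV1)) iC.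
  apply: le_integrable => //; first exact: measurable_potential measurable_interp Xt_gt0.
  move=> x _; rewrite /potential /= lee_fin; apply: le_trans (ler_norm _).
  rewrite ler_norml; apply/andP; split.
    have : (0 <= rho / 2 * Xt x)%R.
      by apply: mulr_ge0; [rewrite divr_ge0// ltW|exact: ltW].
    have := HC _ (Xt_gt0 x); have := ler_norm C.
    have := normr_ge0 (V (X0 x)); have := normr_ge0 (V (X1 x)).
    lra.
  have := cV (ltW t0) (ltW t1) (X0_gt0 x) (X1_gt0 x); rewrite -/(Xt x).
  have : (0 <= rho * (t * (1 - t) * (Num.sqrt (X0 x) - Num.sqrt (X1 x)) ^+ 2))%R.
    apply: mulr_ge0; first exact: ltW.
    apply: mulr_ge0; last exact: sqr_ge0.
    by rewrite mulr_ge0// ?subr_ge0 ltW.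
  have := conv_norm_le (V (X0 x)) (V (X1 x)) (ltW t0) (ltW t1).
  have := ler_norm ((1 - t) * V (X0 x) + t * V (X1 x)); have := normr_ge0 C.
  lra.
have iX01 := integrableD measurableT iX0 iX1.
have iS := integrableD measurableT (integrable_fst iX01) (integrable_snd iX01).
have := integrableD measurableT
  (integrableD measurableT (integrable_abse iK0) (integrable_abse iK1)) iS.
apply: le_integrable => //; first exact: measurable_log_interaction measurable_interp.
move=> [u v] _.
rewrite [leRHS]gee0_abs; last first.
  by rewrite /= !adde_ge0 ?lee_fin//= ltW.
have S0 : (0 <= X0 u + X1 u + (X0 v + X1 v))%R by rewrite !addr_ge0// ltW.
have : (1 - t)%:E * log_interaction X0 (u, v) + t%:E * log_interaction X1 (u, v)
    <= log_interaction Xt (u, v).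
  exact: lne_interp t0 t1 (X0_gt0 u) (X1_gt0 u) (X0_gt0 v) (X1_gt0 v) (X01 u v).
have : log_interaction Xt (u, v) <= (Xt u + Xt v)%:E.
  exact: lne_dist_le (Xt_gt0 u) (Xt_gt0 v).
have XtS w : (Xt w <= X0 w + X1 w)%R by rewrite interp_le// ltW.
have SS : (Xt u + Xt v <= X0 u + X1 u + (X0 v + X1 v))%R by rewrite lerD.
have fin (X : T -> R) : log_interaction X (u, v) != +oo.
  by rewrite /log_interaction /lne; case: ifP.
change (log_interaction Xt (u, v) <= (Xt u + Xt v)%:E ->
  (1 - t)%:E * log_interaction X0 (u, v) + t%:E * log_interaction X1 (u, v)
    <= log_interaction Xt (u, v) ->
  `|log_interaction Xt (u, v)| <= `|log_interaction X0 (u, v)| +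
   `|log_interaction X1 (u, v)| + (X0 u + X1 u + (X0 v + X1 v))%:E).
move: (fin X0) (fin X1).
case: (log_interaction X0 (u, v)) => [a| |] //;
  case: (log_interaction X1 (u, v)) => [b| |] // _ _; try by move=> *; exact: leey.
case: (log_interaction Xt (u, v)) => [c| |] //;
  rewrite -?EFinM -?EFinD ?lee_fin // => h1 h2.
have := conv_norm_le a b (ltW t0) (ltW t1).
rewrite ler_norml => /andP[h3 _].
have := normr_ge0 a; have := normr_ge0 b => h7 h8.
rewrite ler_norml; apply/andP; split; lra.
Qed.

(** Strong displacement convexity of the energy. *)
Lemma rv_energy_interp :
  rv_energy Xt + (rho * (t * (1 - t)))%:E * rv_cost X0 X1 <=
  (1 - t)%:E * rv_energy X0 + t%:E * rv_energy X1.
Proof.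
have [iVt iKt] := finite_energy_interp.
have HV : \int[P]_x potential V Xt x + (rho * (t * (1 - t)))%:E * rv_cost X0 X1 <=
   (1 - t)%:E * \int[P]_x potential V X0 x + t%:E * \int[P]_x potential V X1 x.
  rewrite -!integralZl//; last exact: rv_cost_integrable.
  rewrite -!integralD//; [|exact: integrableZl..|]; last first.
    by apply: integrableZl => //; exact: rv_cost_integrable.
  apply: le_integral => //.
  - by apply: integrableD => //; apply: integrableZl => //; exact: rv_cost_integrable.
  - by apply: integrableD => //; apply: integrableZl.
  - move=> x _; rewrite /potential -!EFinM -!EFinD lee_fin -!mulrA.
    have := cV (ltW t0) (ltW t1) (X0_gt0 x) (X1_gt0 x).
    by rewrite -!mulrA.
have HK : (1 - t)%:E * \int[P \x P]_z log_interaction X0 z +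
          t%:E * \int[P \x P]_z log_interaction X1 z <=
          \int[P \x P]_z log_interaction Xt z.
  rewrite -!integralZl// -!integralD//; [|exact: integrableZl..].
  apply: le_integral => //.
  - by apply: integrableD => //; apply: integrableZl.
  - move=> [u v] _.
    exact: lne_interp t0 t1 (X0_gt0 u) (X1_gt0 u) (X0_gt0 v) (X1_gt0 v) (X01 u v).
move: HV HK; rewrite /rv_energy.
move: (integrable_fin_num measurableT iVt) (integrable_fin_num measurableT iKt).
move: (integrable_fin_num measurableT iV0) (integrable_fin_num measurableT iK0).
move: (integrable_fin_num measurableT iV1) (integrable_fin_num measurableT iK1).
move: (integrable_fin_num measurableT rv_cost_integrable).
rewrite -/(rv_cost X0 X1).
do 7 (move=> /fineK <-).
rewrite -!EFinN -!EFinD !lee_fin.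
lra.
Qed.

End fixed_t.
End comonotone.
End displacement_convexity.

(** * Transport-energy inequality *)

Lemma law_exists d1 d2 (T : measurableType d1) (Y : measurableType d2)
    (R : realType) (P : probability T R) (X : T -> Y) :
  measurable_fun [set: T] X ->
  exists mu : probability Y R, forall A, measurable A -> mu A = P (X @^-1` A).
Proof.
move=> mX.
pose Xmix := isMeasurableFun.Build _ _ _ _ _ mX.
pose Xpack : {mfun T >-> Y} := HB.pack X Xmix.
by exists (distribution P Xpack).
Qed.

Section transport.
Context d (T : measurableType d) (R : realType) (P : probability T R).
Local Open Scope ereal_scope.

Lemma rv_cost_ge0 (X Y : T -> R) : 0 <= rv_cost P X Y.
Proof. by apply: integral_ge0 => x _; rewrite lee_fin sqr_ge0. Qed.

Lemma rv_costC (X Y : T -> R) : rv_cost P X Y = rv_cost P Y X.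
Proof.
by apply: eq_integral => x _; rewrite -sqrrN opprB.
Qed.

Lemma W_le_rv_cost (X Y : T -> R) (mu nu : probR R) :
  measurable_fun [set: T] X -> measurable_fun [set: T] Y ->
  (forall A, measurable A -> mu A = P (X @^-1` A)) ->
  (forall A, measurable A -> nu A = P (Y @^-1` A)) ->
  W mu nu ^+ 2 <= rv_cost P X Y.
Proof.
move=> mX mY muE nuE.
have mXY : measurable_fun [set: T]
    (fun x => (X x, Y x) : measurableTypeR R * measurableTypeR R).
  by apply: measurable_fun_pair.
have [pi piE] := law_exists P mXY.
have cpi : coupling mu nu pi.
  split => A mA; rewrite piE ?muE ?nuE//.
  - by rewrite -[X in measurable X]setTI; exact: measurable_fst.
  - by rewrite -[X in measurable X]setTI; exact: measurable_snd.
have cost : transport_cost pi = rv_cost P X Y.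
  rewrite /transport_cost (ge0_integral_law mXY piE measurableT (fun=> Logic.I))//.
    apply/measurable_EFinP; apply: measurable_funX; apply: measurable_funB.
      by apply: measurableT_comp => //; exact: measurable_sqrt.
    by apply: measurableT_comp => //; exact: measurable_sqrt.
  by move=> y; rewrite lee_fin sqr_ge0.
have WleC : W mu nu <= sqrte (rv_cost P X Y).
  by rewrite -cost; apply: ereal_inf_lbound; exists pi.
rewrite -[leRHS](sqr_sqrte (rv_cost_ge0 X Y)) !expe2.
have W0 : 0 <= W mu nu.
  by apply: le_ereal_inf_tmp => _ [pi' _ <-]; exact: sqrte_ge0.
exact: lee_pmul.
Qed.

End transport.

Lemma quantile_comonotone (R : realType) (mu nu : probR R) (u v : R) :
  mu `]-oo, 0]%classic = 0%E -> nu `]-oo, 0]%classic = 0%E ->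
  0 <= (quantile mu u - quantile mu v) * (quantile nu u - quantile nu v).
Proof.
move=> mu0 nu0; have [uv|/ltW uv] := leP (clip v) (clip u).
  by rewrite mulr_ge0// subr_ge0; apply: quantile_nd.
by rewrite mulr_le0// subr_le0; apply: quantile_nd.
Qed.

Lemma law_on_halfline d (T : measurableType d) (R : realType)
    (P : probability T R) (X : T -> R) (mu : probR R) :
  (forall x, 0 < X x) ->
  (forall A, measurable A -> mu A = P (X @^-1` A)) -> on_halfline mu.
Proof.
move=> X0 muE; rewrite /on_halfline muE; last exact: measurable_itv.
rewrite [X in P X](_ : _ = set0) ?measure0//.
apply/seteqP; split => x //=.
by rewrite in_itv /= => h; have := lt_trans (X0 x) h; rewrite ltxx.
Qed.

(** The transport-energy inequality, for any measurable potential that is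
    uniformly convex in the square root coordinate. *)
Lemma transport_energy (R : realType) (V : R -> R) (rho : R) (muV mu : probR R) :
  measurable_fun (`]0, +oo[%classic : set R) V ->
  0 < rho -> sqrt_uniformly_convex V rho ->
  is_equilibrium V muV -> on_halfline mu ->
  (rho%:E * W mu muV ^+ 2 <= energy V mu - energy V muV)%E.
Proof.
move=> mV rho0 cV eqV hmu.
have [hV minV _] := eqV.
have EV := equilibrium_energy_lty eqV.
have muV0 := finite_energy_pos hV EV.
set P := unit_uniform R.
have mX0 := measurable_quantile muV0.
have X0_gt0 := quantile_gt0 muV0.
have muVE := quantile_law muV0.
have fX0 := iffLR (energy_law_lty mV mX0 X0_gt0 muVE) EV.
have fEV := energy_law_finite mV mX0 X0_gt0 muVE fX0.
have [Emu|] := ltP (energy V mu) +oo%E; last first.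
  rewrite leye_eq => /eqP ->.
  by move: fEV => /fineK <-; rewrite addye// leey.
have mu0 := finite_energy_pos hmu Emu.
have mX1 := measurable_quantile mu0.
have X1_gt0 := quantile_gt0 mu0.
have muE := quantile_law mu0.
have fX1 := iffLR (energy_law_lty mV mX1 X1_gt0 muE) Emu.
have fE := energy_law_finite mV mX1 X1_gt0 muE fX1.
have X01 u v := quantile_comonotone u v muV0 mu0.
have iC := rv_cost_integrable rho0 cV mX0 mX1 X0_gt0 X1_gt0 fX0 fX1.
set C := rv_cost P (quantile muV) (quantile mu).
have Cfin : C \is a fin_num by exact: integrable_fin_num iC.
apply: (@le_trans _ _ (rho%:E * C)%E).
  rewrite lee_pmul2l ?lte_fin// /C rv_costC.
  exact: W_le_rv_cost mX1 mX0 muE muVE.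
(* convexity along the interpolation, and minimality of muV *)
have step t : 0 < t -> t < 1 ->
    (energy V muV + (rho * (t * (1 - t)))%:E * C <=
     (1 - t)%:E * energy V muV + t%:E * energy V mu)%E.
  move=> t0 t1.
  have mXt := measurable_interp mX0 mX1 t.
  have Xt_gt0 (x : measurableTypeR R) : 0 < interp t (quantile muV x) (quantile mu x).
    by rewrite interp_gt0// ltW.
  have fXt := finite_energy_interp mV rho0 cV mX0 mX1 X0_gt0 X1_gt0 X01 fX0 fX1 t0 t1.
  have [nu nuE] := law_exists P (mXt : measurable_fun [set: R] (_ : R -> measurableTypeR R)).
  have := rv_energy_interp mV rho0 cV mX0 mX1 X0_gt0 X1_gt0 X01 fX0 fX1 t0 t1.
  rewrite /rv_energy -(energy_law mV mX0 X0_gt0 muVE fX0) -(energy_law mV mX1 X1_gt0 muE fX1).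
  rewrite -(energy_law mV mXt Xt_gt0 nuE fXt); apply: le_trans.
  rewrite leeD2r//; apply: minV.
  exact: law_on_halfline Xt_gt0 nuE.
move: step => /(_ _ _ _)/=.
have C0 : (0 <= C)%E by exact: rv_cost_ge0.
move: Cfin C0 fE fEV => /fineK <- + /fineK <- /fineK <-.
move: (fine C) (fine (energy V mu)) (fine (energy V muV)) => c e1 e0.
rewrite -EFinN -EFinD -EFinM !lee_fin => c0 step.
have {}step t : 0 < t -> t < 1 -> rho * c * (1 - t) <= e1 - e0.
  move=> t0 t1; have := step t t0 t1.
  rewrite -!EFinM -!EFinD lee_fin => h.
  rewrite -(ler_pM2l t0); lra.
rewrite leNgt; apply/negP => lt.
have h : rho * c * (1 - 2^-1) <= e1 - e0.
  by apply: step; rewrite ?invr_gt0// invf_lt1// ltr1n.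
have rc0 : 0 <= rho * c by rewrite mulr_ge0// ltW.
move: (rho * c) (e1 - e0) rc0 step lt h => q e q0 step lt h.
have q1 : 0 < q by lra.
(* for this t, q (1 - t) is the midpoint of e and q *)
pose t := (q - e) / (2 * q).
have t0 : 0 < t by rewrite divr_gt0// ?subr_gt0// mulr_gt0.
have t1 : t < 1.
  have p2 : 0 < 2 * q by lra.
  by rewrite ltr_pdivrMr//; lra.
have := step t t0 t1.
have -> : q * (1 - t) = (q + e) / 2 by rewrite /t; field; rewrite gt_eqF.
by move=> ?; lra.
Qed.

Lemma C2_pos_measurable (R : realType) (V : R -> R) :
  C2_pos V -> measurable_fun (`]0, +oo[%classic : set R) V.
Proof.
move=> cV; apply: subspace_continuous_measurable_fun; first exact: measurable_itv.
apply: derivable_within_continuous => x.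
by rewrite in_itv /= andbT => /cV[].
Qed.

Lemma integral_probability_cst d (T : measurableType d) (R : realType)
  (P : probability T R) (a : R) : (\int[P]_x a%:E = a%:E)%E.
Proof.
rewrite integral_cst// -[RHS]mule1; congr (_ * _)%E; exact: probability_setT.
Qed.

(** * Sharpness for the Laguerre potentials *)

Section laguerre.
Context (R : realType).
Implicit Types (r s x c : R).

Lemma measurable_log_potential r s :
  measurable_fun (`]0, +oo[%classic : set R) (log_potential r s).
Proof.
apply: measurable_funTS; apply: measurable_funB.
  by apply: measurable_funM.
by apply: measurable_funM => //; exact: measurable_ln.
Qed.

Lemma log_potential_convex r s : 0 <= s ->
  sqrt_uniformly_convex (log_potential r s) r.
Proof.
move=> s0 t x y t0 t1 x0 y0; rewrite /log_potential.
have sx : 0 < Num.sqrt x by rewrite sqrtr_gt0.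
have sy : 0 < Num.sqrt y by rewrite sqrtr_gt0.
rewrite -[in ln x](sqr_sqrtr (ltW x0)) -[in ln y](sqr_sqrtr (ltW y0)).
rewrite -[in r * x](sqr_sqrtr (ltW x0)) -[in r * y](sqr_sqrtr (ltW y0)).
rewrite /interp.
move: (Num.sqrt x) (Num.sqrt y) sx sy => a b a0 b0.
have p : 0 < (1 - t) * a + t * b by nra.
rewrite !lnXn//.
have := ln_conv t0 t1 a0 b0; rewrite -subr_ge0 => h.
have : 0 <= s * 2 * (ln ((1 - t) * a + t * b) - ((1 - t) * ln a + t * ln b)).
  by rewrite mulr_ge0// mulr_ge0.
lra.
Qed.

Lemma log_potential_scale r s c x : 0 < c -> 0 < x ->
  log_potential r s (c * x) =
  log_potential r s x + (r * (c - 1) * x - s * ln c).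
Proof. by move=> c0 x0; rewrite /log_potential lnM ?posrE//; ring. Qed.

Lemma lne_scale c x : 0 < c -> 0 <= x ->
  lne (c * x)%:E = (lne x%:E + (ln c)%:E)%E.
Proof.
move=> c0; rewrite le_eqVlt => /predU1P[<-|x0].
  by rewrite mulr0 le0_lneNy.
by rewrite !lne_EFin ?mulr_gt0// lnM ?posrE// addrC.
Qed.

Section scaling.
Context d (T : measurableType d) (P : probability T R).
Variables (r s : R) (X : T -> R).
Hypotheses (r0 : 0 < r) (s0 : 0 <= s).
Hypotheses (mX : measurable_fun [set: T] X) (X_gt0 : forall x : T, 0 < X x).
Hypothesis fX : finite_energy P (log_potential r s) X.
Variable c : R.
Hypothesis c1 : 1 <= c.
Local Open Scope ereal_scope.

Let V := log_potential r s.
Let c0 : (0 < c)%R := lt_le_trans ltr01 c1.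
Let iX := finite_energy_mean r0 (log_potential_convex r s0) mX X_gt0 fX.
Let cX (x : T) := (c * X x)%R.

Let pE : potential V cX = potential V X \+
  (fun x : T => (r * (c - 1))%:E * (EFin \o X) x + (- (s * ln c))%:E).
Proof.
apply/funext => x.
by rewrite /potential /V /cX log_potential_scale// EFinD EFinB EFinM EFinN.
Qed.

Let kE : log_interaction cX = log_interaction X \+ cst (ln c)%:E.
Proof.
apply/funext => -[u v]; rewrite /log_interaction /cX /=.
by rewrite -mulrBr normrM (gtr0_norm c0) -lne_scale.
Qed.

Let iL : P.-integrable [set: T]
  (fun x : T => (r * (c - 1))%:E * (EFin \o X) x + (- (s * ln c))%:E).
Proof.
apply: integrableD => //; first exact: integrableZl.
exact: finite_measure_integrable_cst.
Qed.

Let iK : (P \x P).-integrable [set: T * T] (cst (ln c)%:E).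
Proof.
have := integrable_fst (finite_measure_integrable_cst P (ln c) measurableT).
by [].
Qed.

Lemma finite_energy_scale : finite_energy P V cX.
Proof.
by split; rewrite ?pE ?kE; apply: integrableD => //; [exact: fX.1|exact: fX.2].
Qed.

(** The interaction decreases under dilation, and so does the logarithmic part of
    the potential: only the linear part contributes. *)
Lemma rv_energy_scale_le :
  rv_energy P V cX <= rv_energy P V X + (r * c)%:E * \int[P]_x (X x)%:E.
Proof.
rewrite /rv_energy.
have ln0 : (0 <= ln c)%R by rewrite ln_ge0.
have m0 : 0 <= \int[P]_x (X x)%:E.
  by apply: integral_ge0 => x _; rewrite lee_fin ltW.
have fm : \int[P]_x (X x)%:E \is a fin_num by exact: integrable_fin_num iX.
have f1 := integrable_fin_num measurableT fX.1.
have f2 := integrable_fin_num measurableT fX.2.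
have EL : \int[P]_x ((r * (c - 1))%:E * (EFin \o X) x + (- (s * ln c))%:E) =
    (r * (c - 1))%:E * \int[P]_x (X x)%:E + (- (s * ln c))%:E.
  rewrite integralD//; last 2 first.
  - exact: integrableZl.
  - exact: finite_measure_integrable_cst.
  by rewrite integralZl// (integral_probability_cst P).
have EK : \int[P \x P]_z (ln c)%:E = (ln c)%:E.
  rewrite integral_cst// -[RHS]mule1; congr (_ * _).
  rewrite -setXTT [LHS]product_measure1E// -[RHS]mule1.
  by congr (_ * _); exact: probability_setT.
have -> : \int[P]_x potential V cX x = \int[P]_x potential V X x +
    ((r * (c - 1))%:E * \int[P]_x (X x)%:E + (- (s * ln c))%:E).
  by rewrite pE integralD ?EL//; exact: fX.1.
have -> : \int[P \x P]_z log_interaction cX z =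
    \int[P \x P]_z log_interaction X z + (ln c)%:E.
  by rewrite kE integralD ?EK//; exact: fX.2.
move: fm f1 f2 m0 => /fineK <- /fineK <- /fineK <-.
move: (fine _) (fine _) (fine _) => b a m.
rewrite lee_fin => m0; rewrite -!EFinN -!EFinD lee_fin.
have : (0 <= s * ln c)%R by rewrite mulr_ge0.
have : (0 <= r * m)%R by rewrite mulr_ge0// ltW.
lra.
Qed.

End scaling.
End laguerre.

(** Dilating by th^2 moves a law by at least (th - 1) times the square root of its
    mean, whatever the coupling: the cost is bounded below by
    (a - b)^2 >= (1 - 1/th) a^2 - (th - 1) b^2. *)
Lemma W_scale_ge d (T : measurableType d) (R : realType) (P : probability T R)
    (X : T -> R) (th : R) (mu nu : probR R) :
  measurable_fun [set: T] X -> (forall x, 0 < X x) ->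
  P.-integrable [set: T] (EFin \o X) -> 1 < th ->
  (forall A, measurable A -> mu A = P ((fun x => th ^+ 2 * X x) @^-1` A)) ->
  (forall A, measurable A -> nu A = P (X @^-1` A)) ->
  (((th - 1) ^+ 2)%:E * \int[P]_x (X x)%:E <= W mu nu ^+ 2)%E.
Proof.
move=> mX X0 iX th1 muE nuE.
have th0 : 0 < th by rewrite (lt_trans ltr01).
set m := (\int[P]_x (X x)%:E)%E.
have m0 : (0 <= m)%E.
  by apply: integral_ge0 => x _; rewrite lee_fin ltW.
have mfin : m \is a fin_num by exact: integrable_fin_num iX.
pose sq (x : R) : \bar R := (Num.sqrt x ^+ 2)%:E.
have msq : measurable_fun [set: measurableTypeR R] (sq : measurableTypeR R -> \bar R).
  by apply/measurable_EFinP; apply: measurable_funX; exact: measurable_sqrt.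
have sq0 x : (0 <= sq x)%E by rewrite lee_fin sqr_ge0.
have mcX : measurable_fun [set: T] (fun x => th ^+ 2 * X x : measurableTypeR R).
  by apply: measurable_funM.
have mu_sq : (\int[mu]_x sq x = (th ^+ 2)%:E * m)%E.
  rewrite (ge0_integral_law mcX muE measurableT (fun=> Logic.I))// /m -integralZl//.
  apply: eq_integral => x _; rewrite /sq sqr_sqrtr ?EFinM//.
  by rewrite mulr_ge0 ?sqr_ge0// ltW.
have nu_sq : (\int[nu]_x sq x = m)%E.
  rewrite (ge0_integral_law (mX : measurable_fun _ (X : T -> measurableTypeR R))
    nuE measurableT (fun=> Logic.I))//.
  by apply: eq_integral => x _; rewrite /sq sqr_sqrtr// ltW.
have WW : (sqrte (((th - 1) ^+ 2)%:E * m) <= W mu nu)%E.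
  apply: le_ereal_inf_tmp => _ [pi [pi1 pi2] <-].
  have cost0 : (0 <= transport_cost pi)%E.
    by apply: integral_ge0 => z _; rewrite lee_fin sqr_ge0.
  rewrite lee_sqrt//.
  have m1 : measurable_fun [set: measurableTypeR R * measurableTypeR R] (fun z => sq z.1).
    by apply: measurableT_comp msq _; exact: measurable_fst.
  have m2 : measurable_fun [set: measurableTypeR R * measurableTypeR R] (fun z => sq z.2).
    by apply: measurableT_comp msq _; exact: measurable_snd.
  have E1 : (\int[pi]_z sq z.1 = (th ^+ 2)%:E * m)%E.
    by rewrite -mu_sq (ge0_integral_law measurable_fst
      (fun A mA => esym (pi1 A mA)) measurableT (fun=> Logic.I)).
  have E2 : (\int[pi]_z sq z.2 = m)%E.
    by rewrite -nu_sq (ge0_integral_law measurable_snd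
      (fun A mA => esym (pi2 A mA)) measurableT (fun=> Logic.I)).
  have th0' : 0 <= 1 - th^-1 by rewrite subr_ge0 invf_le1// ltW.
  have th1' : 0 <= th - 1 by rewrite subr_ge0 ltW.
  have mc : measurable_fun [set: measurableTypeR R * measurableTypeR R]
     (fun z => ((Num.sqrt z.1 - Num.sqrt z.2) ^+ 2)%:E).
    apply/measurable_EFinP; apply: measurable_funX; apply: measurable_funB.
      by apply: measurableT_comp; [exact: measurable_sqrt|exact: measurable_fst].
    by apply: measurableT_comp; [exact: measurable_sqrt|exact: measurable_snd].
  have key : ((1 - th^-1)%:E * \int[pi]_z sq z.1 <=
      transport_cost pi + (th - 1)%:E * \int[pi]_z sq z.2)%E.
    rewrite /transport_cost -!ge0_integralZl// -ge0_integralD//; last 3 first.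
    - by move=> z _; rewrite lee_fin sqr_ge0.
    - by move=> z _; apply: mule_ge0.
    - exact: measurable_funeM.
    apply: ge0_le_integral => //.
    - by move=> z _; apply: mule_ge0.
    - exact: measurable_funeM.
    - by apply: emeasurable_funD => //; exact: measurable_funeM.
    - move=> [z1 z2] _; rewrite /sq /= lee_fin.
      move: (Num.sqrt z1) (Num.sqrt z2) => a b; rewrite -subr_ge0.
      have -> : (a - b) ^+ 2 + (th - 1) * b ^+ 2 - (1 - th^-1) * a ^+ 2 =
          th^-1 * (a - th * b) ^+ 2 by field; rewrite gt_eqF.
      by apply: mulr_ge0; [rewrite invr_ge0 ltW|exact: sqr_ge0].
  move: key; rewrite E1 E2; move: mfin m0 cost0 => /fineK <-.
  move: (fine m) (transport_cost pi) => q [k| |] m0 k0; [|by move=> _; exact: leey|by []].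
  rewrite -!EFinM -!EFinD !lee_fin.
  have -> : (1 - th^-1) * (th ^+ 2 * q) = (th ^+ 2 - th) * q.
    by field; rewrite gt_eqF.
  lra.
have sm : (0 <= ((th - 1) ^+ 2)%:E * m)%E by rewrite mule_ge0// lee_fin sqr_ge0.
rewrite -(sqr_sqrte sm) !expe2; apply: lee_pmul => //; exact: sqrte_ge0.
Qed.

Lemma integral_gt0 d (T : measurableType d) (R : realType) (P : probability T R)
    (X : T -> R) : measurable_fun [set: T] X -> (forall x, 0 < X x) ->
  (0 < \int[P]_x (X x)%:E)%E.
Proof.
move=> mX X0; rewrite lt_neqAle; apply/andP; split; last first.
  by apply: integral_ge0 => x _; rewrite lee_fin ltW.
apply/eqP => I0.
have mXE : measurable_fun [set: T] (fun x => (X x)%:E) by exact/measurable_EFinP.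
have : (\int[P]_x `|(X x)%:E| = 0)%E.
  by rewrite [RHS]I0; apply: eq_integral => x _; rewrite gee0_abs// lee_fin ltW.
move/(ae_eq_integral_abs P measurableT mXE) => [N [mN N0 sN]].
have : P [set: T] = 0%E.
  apply/eqP; rewrite -measure_le0 -N0; apply: le_measure; rewrite ?inE//.
  move=> x _; apply: sN => /= /(_ Logic.I) [] E.
  by have := X0 x; rewrite E ltxx.
by rewrite probability_setT => /eqP; rewrite eqe oner_eq0.
Qed.

(** Dilations by th^2 give rho (th - 1)^2 <= r th^2. *)
Lemma laguerre_sharp (R : realType) (r s rho : R) (muV : probR R) :
  0 < r -> 0 <= s -> is_equilibrium (log_potential r s) muV ->
  (forall mu : probR R, on_halfline mu ->
     (rho%:E * W mu muV ^+ 2 <=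
        energy (log_potential r s) mu - energy (log_potential r s) muV)%E) ->
  rho <= r.
Proof.
move=> r0 s0 eqV H; set V := log_potential r s.
have mV := measurable_log_potential r s.
have cV := log_potential_convex r s0.
have [hV _ _] := eqV.
have EV := equilibrium_energy_lty eqV.
have muV0 := finite_energy_pos hV EV.
set P := unit_uniform R; set X := quantile muV.
have mX := measurable_quantile muV0.
have X_gt0 := quantile_gt0 muV0.
have muVE := quantile_law muV0.
have fX := iffLR (energy_law_lty mV mX X_gt0 muVE) EV.
have fEV := energy_law_finite mV mX X_gt0 muVE fX.
have iX := finite_energy_mean r0 cV mX X_gt0 fX.
have m_gt0 := integral_gt0 P mX X_gt0.
have mfin : (\int[P]_x (X x)%:E)%E \is a fin_num by exact: integrable_fin_num iX.
rewrite leNgt; apply/negP => rrho.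
have rho0 : 0 < rho by rewrite (lt_trans r0).
have step (th : R) : 1 < th -> rho * (th - 1) ^+ 2 <= r * th ^+ 2.
  move=> th1.
  have c1 : 1 <= th ^+ 2 by rewrite exprn_ege1// ltW.
  have mcX : measurable_fun [set: measurableTypeR R]
      (fun x : measurableTypeR R => th ^+ 2 * X x).
    by apply: measurable_funM.
  have cX_gt0 (x : measurableTypeR R) : 0 < th ^+ 2 * X x.
    by rewrite mulr_gt0// (lt_le_trans ltr01).
  have [mu muE] := law_exists P (mcX : measurable_fun _ (_ : _ -> measurableTypeR R)).
  have fcX := finite_energy_scale r0 s0 mX X_gt0 fX c1.
  have hmu : on_halfline mu := law_on_halfline cX_gt0 muE.
  have := H mu hmu.
  have Wge := W_scale_ge mX X_gt0 iX th1 muE muVE.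
  have := rv_energy_scale_le r0 s0 mX X_gt0 fX c1.
  rewrite /rv_energy -(energy_law mV mcX cX_gt0 muE fcX) -(energy_law mV mX X_gt0 muVE fX).
  move=> h1 h2.
  have : (rho%:E * (((th - 1) ^+ 2)%:E * \int[P]_x (X x)%:E) <=
          (r * th ^+ 2)%:E * \int[P]_x (X x)%:E)%E.
    apply: (le_trans _ (le_trans h2 _)).
      by rewrite lee_pmul2l ?lte_fin.
    by rewrite leeBlDl// -/X.
  move: mfin m_gt0 => /fineK <-; move: (fine _) => m.
  by rewrite lte_fin lee_fin => m0; rewrite mulrA ler_pM2r.
(* for this th, rho (1 - 2 / th) = (rho + r) / 2 > r *)
pose th := 4 * rho / (rho - r).
have d0 : 0 < rho - r by rewrite subr_gt0.
have thE : th * (rho - r) = 4 * rho by rewrite /th mulfVK// gt_eqF.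
have th1 : 1 < th by rewrite ltr_pdivlMr//; lra.
have := step th th1; nra.
Qed.

Theorem theorem12 (R : realType) :
  (forall (V : R -> R) (rho : R) (muV : probR R),
     C2_pos V ->
     0 < rho ->
     convex_function (`]0, +oo[%classic : set R^o)
       (fun x : R^o => V (x ^+ 2) - rho * x ^+ 2) ->
     is_equilibrium V muV ->
     forall mu : probR R, on_halfline mu ->
       (rho%:E * W mu muV ^+ 2 <= energy V mu - energy V muV)%E)
  /\
  (forall (r s : R) (muV : probR R),
     0 < r -> 0 <= s ->
     is_equilibrium (log_potential r s) muV ->
     (forall mu : probR R, on_halfline mu ->
        (r%:E * W mu muV ^+ 2 <=
           energy (log_potential r s) mu
           - energy (log_potential r s) muV)%E) /\
     (forall rho : R,
        (forall mu : probR R, on_halfline mu ->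
           (rho%:E * W mu muV ^+ 2 <=
              energy (log_potential r s) mu
              - energy (log_potential r s) muV)%E) ->
        rho <= r)).
Proof.
split=> [V rho muV cV rho0 cvx eqV mu hmu|r s muV r0 s0 eqV].
  apply: transport_energy eqV hmu => //; first exact: C2_pos_measurable.
  exact: convex_function_sqrt.
split=> [mu hmu|rho H]; last exact: laguerre_sharp eqV H.
apply: transport_energy eqV hmu => //; first exact: measurable_log_potential.
exact: log_potential_convex.
Qed.
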